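(* Let $m,n\ge 2$ be integers and let $0=\lambda_1\le\lambda_2\le\cdots\le\lambda_n$ be the Laplacian eigenvalues of the path $P_n$. Then the eigenvalues of the distance Laplacian matrix of the graph $\mathcal{NC}(F_{m,n})$, listed as a multiset of $2(m+n)$ values, are: (1) $5n+3m-\lambda_i$ with multiplicity $2$ for each $2\le i\le n$; (2) $3n+5m-4$ with multiplicity $m-1$; (3) $3n+5m$ with multiplicity $m-1$; (4) $\frac{9}{2}(n+m)-2\pm\frac12\sqrt{A}$, each with multiplicity $1$, where $A=24n+9n^2-14nm-24m+9m^2+16$; (5) $3(n+m)$ with multiplicity $1$; (6) $0$ with multiplicity $1$.
   Context: Graphs are finite, simple and undirected. The Laplacian matrix of a graph $G$ is $L(G)=\mathrm{Deg}(G)-A(G)$, where $A(G)$ is the adjacency matrix and $\mathrm{Deg}(G)$ is the diagonal matrix of vertex degrees; its eigenvalues are the Laplacian eigenvalues of $G$. For a connected graph $G$, $D(G)$ is the distance matrix, whose $(i,j)$ entry is the distance $d(v_i,v_j)$; the transmission of a vertex is the sum of its distances to all other vertices; $Tr(G)$ is the diagonal matrix of vertex transmissions; and the distance Laplacian matrix is $D^L(G)=Tr(G)-D(G)$. The generalized fan graph is $F_{m,n}=\overline{K}_m+P_n$, the join of the graph $\overline{K}_m$ on $m$ vertices with no edges and the path $P_n$ on $n$ vertices (all edges between the two parts are added). For $m,n\ge 2$, the graph $\mathcal{NC}(F_{m,n})$ on $2(m+n)$ vertices is obtained from two disjoint copies of $F_{m,n}$ by adding $m$ edges, joining each vertex of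 $\overline{K}_m$ in the first copy to the corresponding vertex of $\overline{K}_m$ in the second copy. Convention: the spectrum is described as a multiset of eigenvalues counted with multiplicity; if some listed values coincide, their multiplicities add. *)

(* Defs.v *)
From mathcomp Require Import all_boot all_order all_algebra.

Set Implicit Arguments.
Unset Strict Implicit.
Unset Printing Implicit Defensive.

Import Order.TTheory GRing.Theory Num.Theory.
Local Open Scope ring_scope.

Record sgraph := SGraph {
  vertex :> finType;
  edge : rel vertex;
  edge_sym : symmetric edge;
  edge_irr : irreflexive edge }.

Section GraphMatrices.
Variables (G : sgraph) (R : pzRingType).

Definition deg (x : G) : nat := #|[set y | edge x y]|.

Definition walk (k : nat) (x y : G) : bool :=
  [exists p : k.-tuple G, path (@edge G) x p && (last x p == y)].

(* The least length of a walk from x to y. A shortest walk has fewer than #|G|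
   edges, so the search range suffices; the value is #|G| when x and y are not
   connected. *)
Definition dist (x y : G) : nat := find (fun k => walk k x y) (iota 0 #|G|).

Definition transmission (x : G) : nat := (\sum_(y : G) dist x y)%N.

(* Matrices are indexed by the position of a vertex in the enumeration of G. *)
Definition adjacency_mx : 'M[R]_#|G| :=
  \matrix_(i, j) (edge (enum_val i) (enum_val j))%:R.

Definition degree_mx : 'M[R]_#|G| := diag_mx (\row_i (deg (enum_val i))%:R).

Definition laplacian_mx : 'M[R]_#|G| := degree_mx - adjacency_mx.

Definition distance_mx : 'M[R]_#|G| :=
  \matrix_(i, j) (dist (enum_val i) (enum_val j))%:R.

Definition transmission_mx : 'M[R]_#|G| :=
  diag_mx (\row_i (transmission (enum_val i))%:R).

Definition distance_laplacian_mx : 'M[R]_#|G| := transmission_mx - distance_mx.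

End GraphMatrices.

(* The list s, up to order, is the multiset of all eigenvalues of A, counted
   with multiplicity. *)
Definition spectrum_is (R : comNzRingType) (k : nat) (A : 'M[R]_k) (s : seq R) :
  Prop := char_poly A = \prod_(a <- s) ('X - a%:P).

Definition edgeless_rel (m : nat) : rel 'I_m := fun _ _ => false.

Lemma edgeless_sym m : symmetric (@edgeless_rel m). Proof. by []. Qed.
Lemma edgeless_irr m : irreflexive (@edgeless_rel m). Proof. by []. Qed.

Definition edgeless_graph (m : nat) : sgraph :=
  SGraph (@edgeless_sym m) (@edgeless_irr m).

Definition path_rel (n : nat) : rel 'I_n :=
  fun i j => (i.+1 == j :> nat) || (j.+1 == i :> nat).

Lemma path_rel_sym n : symmetric (@path_rel n).
Proof. by move=> i j; rewrite /path_rel orbC. Qed.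
Lemma path_rel_irr n : irreflexive (@path_rel n).
Proof. by move=> i; rewrite /path_rel orbb gtn_eqF. Qed.

Definition path_graph (n : nat) : sgraph :=
  SGraph (@path_rel_sym n) (@path_rel_irr n).

Section Join.
Variables G H : sgraph.

Definition join_rel : rel (G + H)%type := fun x y =>
  match x, y with
  | inl u, inl v => edge u v
  | inr u, inr v => edge u v
  | _, _ => true
  end.

Lemma join_sym : symmetric join_rel.
Proof. by move=> [u|u] [v|v] //=; rewrite edge_sym. Qed.
Lemma join_irr : irreflexive join_rel.
Proof. by move=> [u|u] /=; rewrite edge_irr. Qed.

Definition join_graph : sgraph := SGraph join_sym join_irr.

End Join.

Definition fan_graph (m n : nat) : sgraph :=
  join_graph (edgeless_graph m) (path_graph n).

Section NC.
Variables m n : nat.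

(* The boolean component tells the two copies of the fan apart. *)
Definition NC_rel : rel (bool * fan_graph m n)%type := fun x y =>
  if x.1 == y.1 then edge x.2 y.2
  else match x.2, y.2 with
       | inl u, inl v => u == v
       | _, _ => false
       end.

Lemma NC_sym : symmetric NC_rel.
Proof.
move=> [a x] [b y]; rewrite /NC_rel /= eq_sym [join_rel x y]join_sym.
by case: ifP => // _; case: x y => [u|u] [v|v].
Qed.
Lemma NC_irr : irreflexive NC_rel.
Proof. by move=> [a x]; rewrite /NC_rel /= eqxx join_irr. Qed.

Definition NC_fan_graph : sgraph := SGraph NC_sym NC_irr.

End NC.

(* Main.v *)
Require Import Defs.
From mathcomp Require Import all_boot all_order all_fingroup all_algebra zify ring.

Set Implicit Arguments.
Unset Strict Implicit.
Unset Printing Implicit Defensive.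

Import Order.TTheory GRing.Theory Num.Theory.
Local Open Scope ring_scope.

(** Every distance in the graph is at most 3 and is read off from the kind of
    the two vertices, the copies they lie in, and, for two path vertices of the
    same copy, their adjacency. So the distance Laplacian has the block form
    ((P, Q), (Q, P)), the blocks being indexed by the two copies, and its
    characteristic polynomial is the product of those of P + Q and P - Q
    ([char_poly_swap]).

    With J the all-ones blocks and L the Laplacian of the path, these two
    matrices have the shape
      ((u I + a J, b J), (b J, v I - L + a J)),   v = 5n + 3m,
    with u = 5m + 3n, a = -5, b = -3 for P + Q and u = 5m + 3n - 4, a = b = 1
    for P - Q ([char_poly_distance_laplacian]).

    Since L kills the all-ones vector, both matrices respect the partition of
    the vertices into the edgeless part and the path. A vector with zero sum on
    each part does not see the J blocks, which yields u with multiplicity m - 1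
    and v - lambda_i for the nonzero part of the spectrum of L; the two
    remaining eigenvalues are those of the 2 x 2 quotient
      ((u + m a, n b), (m b, v + n a)).
    Determinants express this without choosing bases of eigenvectors:
    [char_poly_add_mul] compares the characteristic polynomial of B + W Z, where
    B W = W C, with that of the small matrix C + Z W, and
    [char_poly_two_cells] is the instance in which the columns of W are the
    indicators of the two parts. The quotient of P + Q has the eigenvalues 0 and
    3(m + n), and the discriminant of the quotient of P - Q is A. *)

(** * Distances from a potential *)

Lemma walk0 (G : sgraph) (x y : G) : walk 0 x y = (x == y).
Proof.
apply/existsP/eqP => [[p]|->]; first by rewrite tuple0 => /eqP.
by exists [tuple]; apply/eqP.
Qed.

Lemma walkS (G : sgraph) k (x y : G) :
  walk k.+1 x y = [exists z, edge x z && walk k z y].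
Proof.
apply/existsP/existsP => [[p]|[z /andP[xz /existsP[p zpy]]]].
  case/tupleP: p => z p /=; rewrite -andbA => /andP[xz zpy].
  by exists z; rewrite xz; apply/existsP; exists p.
by exists [tuple of z :: p]; rewrite /= xz.
Qed.

Lemma dist_least (G : sgraph) (x y : G) d :
  (d < #|G|)%N -> walk d x y -> (forall k, walk k x y -> (d <= k)%N) ->
  dist x y = d.
Proof.
move=> ltdG xy_d le_d; rewrite /dist -(subnKC (ltnW ltdG)) iotaD find_cat.
rewrite size_iota -(subnSK ltdG) /= xy_d addn0 ifF //.
apply/hasP=> -[k]; rewrite mem_iota add0n => /andP[_ ltkd] /le_d.
by rewrite leqNgt ltkd.
Qed.

(** The distance to y is the only potential that vanishes exactly at y, changes
    by at most one along an edge and can always be decreased by moving to a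
    neighbour: the second property bounds the length of walks from below, and
    following the third one builds a walk of that length. *)
Lemma dist_eq_potential (G : sgraph) (y : G) (f : G -> nat) :
    (forall x, (f x < #|G|)%N) -> f y = 0%N -> (forall x, f x = 0%N -> x = y) ->
    (forall x z, edge x z -> (f x <= (f z).+1)%N) ->
    (forall x, (0 < f x)%N -> exists2 z, edge x z & f x = (f z).+1) ->
  forall x, dist x y = f x.
Proof.
move=> f_lt fy f0 f_lip f_desc x; apply: dist_least => //.
  move: {-1}(f x) (erefl (f x)) => d; elim: d x => [|d IHd] x fxd.
    by rewrite walk0 (f0 x).
  have [|z xz fxz] := f_desc x; first by rewrite fxd.
  rewrite walkS; apply/existsP; exists z; rewrite xz IHd //.
  by move: fxz; rewrite fxd => -[].
move=> k; elim: k x => [|k IHk] x; first by rewrite walk0 => /eqP->; rewrite fy.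
rewrite walkS => /existsP[z /andP[xz /IHk fz]].
exact: leq_trans (f_lip _ _ xz) _.
Qed.

(** * Distances in the graph *)

Definition NC_dist m n (x y : bool * ('I_m + 'I_n)) : nat :=
  (match x.2, y.2 with
  | inl u, inl v => (x.1 != y.1) + 2 * (u != v)
  | inr i, inr j =>
      if x.1 != y.1 then 3
      else if i == j then 0 else if path_rel i j then 1 else 2
  | _, _ => 1 + (x.1 != y.1)
  end)%N.

Lemma NC_dist_lipschitz m n (x y z : NC_fan_graph m n) :
  edge x z -> (NC_dist x y <= (NC_dist z y).+1)%N.
Proof.
case: x z y => [a [u|i]] [c [w|k]] [b [v|j]]; rewrite /NC_dist /edge /= /NC_rel /=.
all: move: a b c => [] [] [] //=; rewrite ?addn0 ?add0n //.
all: try by move=> /eqP->; case: (w != v).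
all: try by case: (u != v).
all: try by case: (i == j) => //; case: path_rel.
all: case: (i =P j) => // _; case: (k =P j) => [->|_]; first by move->.
all: by case: (path_rel i j); case: (path_rel k j).
Qed.

(** Both parts have to be nonempty: two vertices of one part reach each
    other through a vertex of the other part. *)
Lemma NC_dist_descent m n (x y : NC_fan_graph m n) :
    (0 < m)%N -> (0 < n)%N -> (0 < NC_dist x y)%N ->
  exists2 z : NC_fan_graph m n, edge x z & NC_dist x y = (NC_dist z y).+1.
Proof.
move=> m_gt0 n_gt0; pose u0 := Ordinal m_gt0; pose i0 := Ordinal n_gt0.
case: x y => [a [u|i]] [b [v|j]]; rewrite /NC_dist /=.
- case: (u =P v) => [-> | nuv] /=; rewrite ?muln0 ?addn0.
    case: (a =P b) => // /eqP nab _.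
    exists (b, inl v); rewrite /edge /= /NC_rel /= ?(negPf nab) ?eqxx //.
  exists (a, inr i0); rewrite /edge /= /NC_rel /= ?eqxx //.
  by case: (a == b).
- move=> _; exists (b, if a == b then inr j else inl u).
    by rewrite /edge /= /NC_rel /=; case: (a == b).
  by case: (a == b); rewrite /= eqxx ?eqxx.
- move=> _; exists (a, inl v); rewrite /edge /= /NC_rel /= ?eqxx //.
  by rewrite muln0 addn0; case: (a == b).
- case: (a =P b) => [->|/eqP nab] /=.
    case: (i =P j) => // _ _; case ij: (path_rel i j) => /=.
      by exists (b, inr j); rewrite /edge /= /NC_rel /= ?eqxx.
    by exists (b, inl u0); rewrite /edge /= /NC_rel /= ?eqxx.
  exists (a, inl u0); rewrite /edge /= /NC_rel /= ?eqxx //.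
  by rewrite nab.
Qed.

Lemma dist_NC m n (x y : NC_fan_graph m n) :
  (0 < m)%N -> (0 < n)%N -> dist x y = NC_dist x y.
Proof.
move=> m_gt0 n_gt0; apply: (@dist_eq_potential _ y (fun x => NC_dist x y)).
- move=> {}x; rewrite /= card_prod card_sum card_bool !card_ord.
  apply: (@leq_ltn_trans 3); last by lia.
  case: x y => [a [u|i]] [b [v|j]]; rewrite /NC_dist /=; try by case: (a != b).
    by case: (a != b); case: (u != v).
  by case: (a != b) => //; case: (i == j) => //; case: path_rel.
- by case: y => b [v|j]; rewrite /NC_dist /= !eqxx.
- case=> a [u|i]; case: y => b [v|j]; rewrite /NC_dist //=.
    by case: (a =P b) => // ->; case: (u =P v) => // ->.
  by case: (a =P b) => // -> /=; case: (i =P j) => [->|] // _; case: path_rel.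
- by move=> {}x z; apply: NC_dist_lipschitz.
- by move=> {}x; apply: NC_dist_descent.
Qed.

(** * Determinants and characteristic polynomials *)

Lemma det_reindex (R : comNzRingType) (T : finType) k (h : 'I_k -> T)
    (f : T -> T -> R) : bijective h ->
  \det (\matrix_(i, j < #|T|) f (enum_val i) (enum_val j))
    = \det (\matrix_(i, j) f (h i) (h j)).
Proof.
move=> bij_h; have def_k : k = #|T| by rewrite -(bij_eq_card bij_h) card_ord.
subst k.
have inj_s : injective (enum_rank \o h).
  exact: inj_comp enum_rank_inj (bij_inj bij_h).
set A := \matrix_(i, j) _; pose p := perm inj_s.
rewrite [RHS](_ : _ = \det (row_perm p (col_perm p A))).
  rewrite row_permE col_permE !det_mulmx !det_perm odd_permV mulrC -mulrA.
  by rewrite -signr_addb addbb mulr1.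
by congr (\det _); apply/matrixP=> i j; rewrite !mxE !permE /= !enum_rankK.
Qed.

(** Matrices of a graph are indexed by the position of a vertex in the
    enumeration of the vertex type; this allows a numbering of the vertices that
    displays the block structure. *)
Lemma char_poly_reindex (R : comNzRingType) (T : finType) k (h : 'I_k -> T)
    (f : T -> T -> R) : bijective h ->
  char_poly (\matrix_(i, j < #|T|) f (enum_val i) (enum_val j))
    = char_poly (\matrix_(i, j) f (h i) (h j)).
Proof.
move=> bij_h; pose g x y := 'X *+ (x == y) - (f x y)%:P.
rewrite /char_poly.
transitivity (\det (\matrix_(i, j < #|T|) g (enum_val i) (enum_val j))).
  by congr (\det _); apply/matrixP=> i j; rewrite !mxE /g (inj_eq enum_val_inj).
rewrite (det_reindex _ bij_h); congr (\det _); apply/matrixP=> i j.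
by rewrite !mxE /g (inj_eq (bij_inj bij_h)).
Qed.

Lemma char_poly_mx_block (R : nzRingType) m n (A : 'M[R]_m) B C (D : 'M[R]_n) :
  char_poly_mx (block_mx A B C D) =
  block_mx (char_poly_mx A) (- map_mx polyC B)
           (- map_mx polyC C) (char_poly_mx D).
Proof.
rewrite /char_poly_mx map_block_mx scalar_mx_block opp_block_mx add_block_mx.
by rewrite !add0r.
Qed.

Lemma char_poly_swap (R : comNzRingType) k (P Q : 'M[R]_k) :
  char_poly (block_mx P Q Q P) = char_poly (P + Q) * char_poly (P - Q).
Proof.
rewrite /char_poly char_poly_mx_block.
set M := char_poly_mx P; set N := - _.
have -> : char_poly_mx (P + Q) = M + N.
  by rewrite /char_poly_mx map_mxD opprD addrA.
have -> : char_poly_mx (P - Q) = M - N.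
  by rewrite /char_poly_mx map_mxB !opprB opprK /M /N /char_poly_mx addrCA addrC.
(* Change to the basis of symmetric and antisymmetric vectors. *)
have fold_eq : block_mx 1%:M 1%:M 0 1%:M *m block_mx M N N M
    *m block_mx 1%:M (- 1%:M) 0 1%:M = block_mx (M + N) 0 N (M - N).
  rewrite !mulmx_block !(mul1mx, mul0mx, mulmx1, mulmx0, mulmxN, add0r, addr0).
  by rewrite [N + M]addrC addNr [- N + M]addrC.
have := congr1 determinant fold_eq.
by rewrite !det_mulmx !det_ublock det_lblock !det1 !mul1r !mulr1.
Qed.

Lemma det_block11 (R : comNzRingType) (x y z t : 'M[R]_1) :
  \det (block_mx x y z t) = x 0 0 * t 0 0 - y 0 0 * z 0 0.
Proof.
rewrite (expand_det_row _ (lshift 1 0)) big_split_ord /= !big_ord1.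
rewrite block_mxEul block_mxEur /cofactor !det_mx11 !mxE /= expr0 expr1.
have -> (i : 'I_1) : @lift (1 + 1) (lshift 1 ord0) i = rshift 1 0 :> 'I_(1 + 1).
  by apply/val_inj; case: i => -[].
have -> (i : 'I_1) : @lift (1 + 1) (rshift 1 ord0) i = lshift 1 0 :> 'I_(1 + 1).
  by apply/val_inj; case: i => -[].
by rewrite !(unsplitK (inr _)) row_mxEl row_mxEr mul1r mulN1r mulrN.
Qed.

(** The relation B W = W C says that the columns of W span a B-invariant space,
    on which B acts as C. The perturbation W Z has its image in that space and
    turns the action C into C + Z W, while the action on the quotient by that
    space is unchanged. *)
Lemma char_poly_add_mul (R : comNzRingType) k l
    (B : 'M[R]_k) (C : 'M_l) (W : 'M_(k, l)) (Z : 'M_(l, k)) :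
  B *m W = W *m C ->
  char_poly (B + W *m Z) * char_poly C = char_poly B * char_poly (C + Z *m W).
Proof.
move=> BW; rewrite /char_poly.
set b := char_poly_mx B; set c := char_poly_mx C.
pose w := map_mx polyC W; pose z := map_mx polyC Z.
have bw : b *m w = w *m c.
  rewrite mulmxBl mulmxBr -!map_mxM BW; congr (_ - _).
  by rewrite scalar_mxC.
have -> : char_poly_mx (B + W *m Z) = b - w *m z.
  by rewrite /char_poly_mx map_mxD map_mxM opprD addrA.
have -> : char_poly_mx (C + Z *m W) = c - z *m w.
  by rewrite /char_poly_mx map_mxD map_mxM opprD addrA.
(* The determinant of the same bordered matrix is computed in two ways:
   clearing z gives the left factor, clearing w with the help of bw the
   right-hand side. *)
have d1 : \det (block_mx b w z 1%:M) = \det (b - w *m z).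
  have := det_mulmx (block_mx b w z 1%:M) (block_mx 1%:M 0 (- z) 1%:M).
  rewrite det_lblock !det1 !mulr1 mulmx_block.
  rewrite !(mulmx1, mul1mx, mulmx0, mulmxN, add0r) subrr.
  by rewrite det_ublock det1 mulr1 => <-.
rewrite -d1.
have := det_mulmx (block_mx b w z 1%:M) (block_mx 1%:M (- w) 0 c).
rewrite det_ublock det1 mul1r => <-.
rewrite mulmx_block !(mulmx1, mul1mx, mulmx0, mulmxN, addr0) bw addNr.
by rewrite det_lblock addrC.
Qed.

(** Adding constant blocks to a block diagonal matrix whose blocks have constant
    row sums u and v only affects the vectors that are constant on each cell:
    there, diag(u, v) is replaced by ((u + m a, n b), (m c, v + n d)). *)
Lemma char_poly_two_cells (R : comNzRingType) m n (U : 'M[R]_m) (V : 'M[R]_n)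
    (u v a b c d : R) :
    U *m const_mx 1 = u *: const_mx 1 :> 'cV_m ->
    V *m const_mx 1 = v *: const_mx 1 :> 'cV_n ->
  char_poly (block_mx (U + const_mx a) (const_mx b)
                      (const_mx c) (V + const_mx d))
     * (('X - u%:P) * ('X - v%:P))
  = char_poly U * char_poly V
     * (('X - (u + m%:R * a)%:P) * ('X - (v + n%:R * d)%:P)
          - (m%:R * n%:R * (b * c))%:P).
Proof.
move=> U1 V1.
(* The columns of W are the indicator vectors of the two cells, and the
   constant blocks are W *m Z. *)
pose W : 'M[R]_(m + n, 1 + 1) := block_mx (const_mx 1) 0 0 (const_mx 1).
pose Z : 'M[R]_(1 + 1, m + n) :=
  block_mx (const_mx a) (const_mx b) (const_mx c) (const_mx d).
pose C : 'M[R]_(1 + 1) := block_mx u%:M 0 0 v%:M.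
have cMn p k l (x y : R) :
    (const_mx x : 'M_(k, p)) *m const_mx y = const_mx (p%:R * (x * y))
      :> 'M_(k, l).
  apply/matrixP=> i j; rewrite !mxE.
  rewrite (eq_bigr (fun=> x * y)) => [|s _]; last by rewrite !mxE.
  by rewrite sumr_const card_ord mulr_natl.
have := @char_poly_add_mul R _ _ (block_mx U 0 0 V) C W Z.
rewrite /W /C /Z !mulmx_block !(mulmx0, mul0mx, addr0, add0r) !cMn U1 V1.
rewrite !mul_mx_scalar => /(_ erefl); rewrite !add_block_mx !add0r !mulr1 !mul1r.
have det_cells (x y z t : 'M[R]_1) :
    char_poly (block_mx x y z t : 'M_(1 + 1)) =
      ('X - (x 0 0)%:P) * ('X - (t 0 0)%:P) - (y 0 0 * z 0 0)%:P.
  rewrite /char_poly char_poly_mx_block det_block11 !mxE.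
  by rewrite polyCM /= mulrNN.
have char_diag k l (A : 'M[R]_k) (B : 'M_l) :
    char_poly (block_mx A 0 0 B) = char_poly A * char_poly B.
  by rewrite /char_poly char_poly_mx_block !map_mx0 !oppr0 det_ublock.
rewrite !det_cells char_diag !mxE /= !mulr1n mul0r polyC0 subr0 => ->.
by rewrite [n%:R * b * _]mulrACA [n%:R * m%:R]mulrC.
Qed.

(** Over an integral domain the factors of the eigenvalues u and v, which belong
    to the all-ones vectors, can be cancelled. *)
Lemma spectrum_two_cells (R : idomainType) m n (U : 'M[R]_m) (V : 'M[R]_n)
    (u v a b c d : R) r s :
    U *m const_mx 1 = u *: const_mx 1 :> 'cV_m ->
    V *m const_mx 1 = v *: const_mx 1 :> 'cV_n ->
    spectrum_is U (u :: r) -> spectrum_is V (v :: s) ->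
  char_poly (block_mx (U + const_mx a) (const_mx b)
                      (const_mx c) (V + const_mx d))
  = \prod_(x <- r) ('X - x%:P) * \prod_(x <- s) ('X - x%:P)
     * (('X - (u + m%:R * a)%:P) * ('X - (v + n%:R * d)%:P)
          - (m%:R * n%:R * (b * c))%:P).
Proof.
rewrite /spectrum_is !big_cons => U1 V1 Ur Vs.
have nz : ('X - u%:P) * ('X - v%:P) != 0 by rewrite mulf_neq0 ?polyXsubC_eq0.
by apply: (mulIf nz); rewrite (char_poly_two_cells _ _ _ _ U1 V1) Ur Vs; ring.
Qed.

Lemma spectrum_scalar (R : comNzRingType) m (u : R) :
  spectrum_is (u%:M : 'M_m) (nseq m u).
Proof.
rewrite /spectrum_is char_poly_trig ?scalar_mx_is_trig // big_nseq.
rewrite (eq_bigr (fun=> 'X - u%:P)) => [|i _]; last by rewrite mxE eqxx.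
by rewrite prodr_const card_ord iter_mulr_1.
Qed.

Lemma quadratic_factor (R : comNzRingType) (a b t c d : R) :
    a + b = c + d -> a * b - t = c * d ->
  ('X - a%:P) * ('X - b%:P) - t%:P = ('X - c%:P) * ('X - d%:P).
Proof.
move=> sum_ab prod_ab; transitivity ('X ^+ 2 - (a + b)%:P * 'X + (a * b - t)%:P).
  by rewrite polyCD polyCB polyCM; ring.
by rewrite sum_ab prod_ab polyCD polyCM; ring.
Qed.

(** The characteristic polynomial of c - A is, up to sign, that of A evaluated
    at c - X. *)
Lemma spectrum_is_scalar_sub (R : idomainType) k (A : 'M[R]_k) (c : R) s :
  spectrum_is A s -> spectrum_is (c%:M - A) [seq c - a | a <- s].
Proof.
rewrite /spectrum_is => As.
have size_s : size s = k.
  by have := size_char_poly A; rewrite As size_prod_XsubC => -[].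
have -> : char_poly (c%:M - A) = (-1) ^+ k * (char_poly A \Po (c%:P - 'X)).
  rewrite /char_poly -det_map_mx -detZ; congr (\det _); apply/matrixP=> i j.
  rewrite !mxE /= comp_polyB comp_polyC polyCB; case: (i == j) => /=.
    by rewrite !mulr1n comp_polyX; ring.
  by rewrite !mulr0n comp_poly0 polyC0; ring.
rewrite As -size_s rmorph_prod big_map /= -[size s]sum1_size.
rewrite -prodrXr /= -big_split /=; apply: eq_bigr => a _.
by rewrite rmorphB /= comp_polyX comp_polyC rmorphB; ring.
Qed.

(** * Entries of the distance Laplacian *)

Lemma sum_affine_delta (R : comNzRingType) n (i : 'I_n) (x y : R) :
  \sum_(j < n) (x - y * (i == j)%:R) = x * n%:R - y.
Proof.
rewrite sumrB sumr_const card_ord mulr_natr -mulr_sumr (bigD1 i) //= eqxx.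
by rewrite big1 ?addr0 ?mulr1 // => j /negPf nij; rewrite eq_sym nij.
Qed.

Lemma sum_edge (R : pzRingType) (G : sgraph) (x : G) :
  \sum_(y : G) (edge x y)%:R = (deg x)%:R :> R.
Proof.
by rewrite -natr_sum -big_mkcond sum1_card /deg cardsE.
Qed.

Lemma NC_dist_inlE (R : comNzRingType) m n c b (u v : 'I_m) :
  (NC_dist (c, inl u) (b, inl v : 'I_m + 'I_n))%:R
    = (c != b)%:R + 2 - 2 * (u == v)%:R :> R.
Proof. by rewrite /NC_dist /= natrD natrM; case: (u == v) => /=; ring. Qed.

Lemma NC_dist_inrE (R : comNzRingType) m n c (i j : 'I_n) :
  (NC_dist (c, inr i : 'I_m + 'I_n) (c, inr j))%:R
    = 2 - 2 * (i == j)%:R - (path_rel i j)%:R :> R.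
Proof.
rewrite /NC_dist /= eqxx /=; have [->|_] := eqVneq i j.
  by rewrite path_rel_irr /=; ring.
by case: (path_rel i j) => /=; ring.
Qed.

Lemma transmissionE (R : pzRingType) m n (x : NC_fan_graph m n) :
    (0 < m)%N -> (0 < n)%N ->
  (transmission x)%:R =
    \sum_(u < m) ((NC_dist x (true, inl u))%:R + (NC_dist x (false, inl u))%:R)
    + \sum_(i < n) ((NC_dist x (true, inr i))%:R + (NC_dist x (false, inr i))%:R)
    :> R.
Proof.
move=> m_gt0 n_gt0; rewrite /transmission natr_sum.
rewrite (eq_bigr (fun y => (NC_dist x y)%:R)); last by move=> y _; rewrite dist_NC.
rewrite -(pair_bigA _ (fun b s => (NC_dist x (b, s))%:R)) /= big_bool /=.
by rewrite !big_sumType /= addrACA -!big_split.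
Qed.

Lemma transmission_inl (R : comNzRingType) m n c (u : 'I_m) :
    (0 < m)%N -> (0 < n)%N ->
  (transmission ((c, inl u) : NC_fan_graph m n))%:R = 5 * m%:R + 3 * n%:R - 4 :> R.
Proof.
move=> m_gt0 n_gt0; rewrite transmissionE //.
rewrite (eq_bigr (fun v => 5 - 4 * (u == v)%:R)) => [|v _]; last first.
  by rewrite !NC_dist_inlE; case: c => /=; ring.
rewrite sum_affine_delta (eq_bigr (fun=> 3)) => [|i _]; last first.
  by rewrite /NC_dist; case: c => /=; ring.
by rewrite sumr_const card_ord -mulr_natr; ring.
Qed.

Lemma transmission_inr (R : comNzRingType) m n c (i : 'I_n) :
    (0 < m)%N -> (0 < n)%N ->
  (transmission ((c, inr i) : NC_fan_graph m n))%:R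
    = 5 * n%:R + 3 * m%:R - 2 - (deg (i : path_graph n))%:R :> R.
Proof.
move=> m_gt0 n_gt0; rewrite transmissionE //.
rewrite (eq_bigr (fun=> 3)) => [|u _]; last first.
  by rewrite /NC_dist; case: c => /=; ring.
pose F j : R := 5 - 2 * (i == j)%:R - (path_rel i j)%:R.
rewrite [X in _ + X](eq_bigr F) => [|j _]; last first.
  by case: c; rewrite /F NC_dist_inrE /NC_dist /=; ring.
rewrite sumrB sum_affine_delta (sum_edge R (i : path_graph n)).
by rewrite sumr_const card_ord -mulr_natr; ring.
Qed.

(** The path Laplacian with rows and columns numbered along the path, so that it
    can be a block of the distance Laplacian. *)
Definition path_laplacian (R : pzRingType) n : 'M[R]_n :=
  \matrix_(i, j) ((deg (i : path_graph n))%:R *+ (i == j) - (path_rel i j)%:R).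

Lemma char_poly_path_laplacian (R : comNzRingType) n :
  char_poly (laplacian_mx (path_graph n) R) = char_poly (path_laplacian R n).
Proof.
rewrite /path_laplacian -(@char_poly_reindex _ 'I_n _ id
  (fun i j => (deg (i : path_graph n))%:R *+ (i == j) - (path_rel i j)%:R)).
  by congr char_poly; apply/matrixP => i j; rewrite !mxE (inj_eq enum_val_inj).
by exists id.
Qed.

Lemma path_laplacian_const (R : pzRingType) n :
  path_laplacian R n *m const_mx 1 = 0 :> 'cV_n.
Proof.
apply/matrixP=> i k; rewrite !mxE.
under eq_bigr => j _ do rewrite !mxE mulr1.
rewrite sumrB (sum_edge R (i : path_graph n)) (bigD1 i) //= eqxx.
rewrite big1 ?addr0 ?subrr //.
by move=> j /negPf nij; rewrite eq_sym nij.
Qed.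

Definition NC_index m n (k : 'I_((m + n) + (m + n))) : NC_fan_graph m n :=
  match split k with inl s => (false, split s) | inr s => (true, split s) end.

Lemma NC_index_bij m n : bijective (@NC_index m n).
Proof.
exists (fun x => unsplit (if x.1 then inr (unsplit x.2) else inl (unsplit x.2))).
  move=> k; rewrite /NC_index -[RHS]splitK.
  by case: (split k) => s; rewrite /= splitK.
by case=> [[] s]; rewrite /NC_index unsplitK /= unsplitK.
Qed.

(** The factors come from the vectors that agree on the two copies and from
    those that are opposite on them. *)
Lemma char_poly_distance_laplacian (R : comNzRingType) m n :
    (0 < m)%N -> (0 < n)%N ->
  char_poly (distance_laplacian_mx (NC_fan_graph m n) R)
  = char_poly (block_mx
        (((5 * m%:R + 3 * n%:R)%:M : 'M_m) + const_mx (- 5)) (const_mx (- 3))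
        (const_mx (- 3))
        ((5 * n%:R + 3 * m%:R)%:M - path_laplacian R n + const_mx (- 5)))
  * char_poly (block_mx
        (((5 * m%:R + 3 * n%:R - 4)%:M : 'M_m) + const_mx 1) (const_mx 1)
        (const_mx 1)
        ((5 * n%:R + 3 * m%:R)%:M - path_laplacian R n + const_mx 1)).
Proof.
move=> m_gt0 n_gt0.
pose g (x y : NC_fan_graph m n) : R :=
  (transmission x)%:R *+ (x == y) - (dist x y)%:R.
transitivity (char_poly
    (\matrix_(i, j < #|NC_fan_graph m n|) g (enum_val i) (enum_val j))).
  by congr char_poly; apply/matrixP => i j; rewrite !mxE /g (inj_eq enum_val_inj).
rewrite (char_poly_reindex _ (@NC_index_bij m n)).
(* P couples vertices of the same copy and Q vertices of different copies;
   the 2%:M in Q accounts for the matching, along which the distance drops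
   from 3 to 1. *)
pose P : 'M[R]_(m + n) := block_mx
  (((5 * m%:R + 3 * n%:R - 2)%:M : 'M_m) - const_mx 2) (const_mx (- 1))
  (const_mx (- 1))
  ((5 * n%:R + 3 * m%:R)%:M - path_laplacian R n - const_mx 2).
pose Q : 'M[R]_(m + n) := block_mx
  ((2%:M : 'M_m) - const_mx 3) (const_mx (- 2))
  (const_mx (- 2)) (const_mx (- 3)).
transitivity (char_poly (block_mx P Q Q P)).
{ congr char_poly; apply/matrixP=> i j; rewrite /P /Q !mxE /g /NC_index dist_NC //.
  case: (split i) => s; rewrite mxE; case: (split j) => t; rewrite mxE.
  all: case: (split s) => u; rewrite mxE; case: (split t) => v; rewrite ?mxE.
  all: rewrite ?NC_dist_inlE ?NC_dist_inrE.
  all: rewrite ?transmission_inl ?transmission_inr // xpair_eqE /NC_dist /=.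
  all: rewrite ?[inl _ == inl _]/(_ == _) ?[inr _ == inr _]/(_ == _).
  all: try by case: (u == v) => /=; ring.
  all: try by ring.
}
rewrite char_poly_swap /P /Q opp_block_mx !add_block_mx.
by congr (_ * _); congr char_poly; congr block_mx; apply/matrixP=> i j;
  rewrite !mxE; try case: (i == j); rewrite /=; ring.
Qed.

(** * The spectrum *)

Theorem theorem4p4 (R : rcfType) (m n : nat) (lam : nat -> R)
  (hm : (2 <= m)%N) (hn : (2 <= n)%N)
  (hlam1 : lam 1%N = 0)
  (hlam_sorted : forall i : nat, (1 <= i < n)%N -> lam i <= lam i.+1)
  (hlam : spectrum_is (laplacian_mx (path_graph n) R)
            [seq lam i | i <- iota 1 n]) :
  let A : R := 24 * n%:R + 9 * n%:R ^+ 2 - 14 * n%:R * m%:R - 24 * m%:R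
               + 9 * m%:R ^+ 2 + 16 in
  spectrum_is (distance_laplacian_mx (NC_fan_graph m n) R)
    (flatten [seq nseq 2 (5 * n%:R + 3 * m%:R - lam i) | i <- iota 2 n.-1]
     ++ nseq m.-1 (3 * n%:R + 5 * m%:R - 4)
     ++ nseq m.-1 (3 * n%:R + 5 * m%:R)
     ++ [:: 9 / 2 * (n%:R + m%:R) - 2 + 1 / 2 * Num.sqrt A;
            9 / 2 * (n%:R + m%:R) - 2 - 1 / 2 * Num.sqrt A;
            3 * (n%:R + m%:R);
            0]).
Proof.
move=> A; have m_gt0 := ltnW hm; have n_gt0 := ltnW hn.
have A_ge0 : 0 <= A.
  (* A is the discriminant of the antisymmetric 2 x 2 quotient
     ((6m + 3n - 4, n), (m, 6n + 3m)): squared difference of the diagonal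
     entries plus 4 times the product of the others. *)
  have -> : A = (3 * m%:R - 3 * n%:R - 4) ^+ 2 + 4 * m%:R * n%:R.
    by rewrite /A; ring.
  by rewrite addr_ge0 ?sqr_ge0 // -!natrM ler0n.
rewrite /spectrum_is char_poly_path_laplacian in hlam.
pose v : R := 5 * n%:R + 3 * m%:R.
pose V := v%:M - path_laplacian R n.
pose s := [seq v - lam i | i <- iota 2 n.-1].
have V_s : spectrum_is V (v :: s).
  have := spectrum_is_scalar_sub v hlam; rewrite -map_comp.
  by rewrite -[in iota 1 n](prednK n_gt0) /= hlam1 subr0.
have V1 : V *m const_mx 1 = v *: const_mx 1 :> 'cV_n.
  by rewrite mulmxBl path_laplacian_const subr0 mul_scalar_mx.
have U_r u : spectrum_is (u%:M : 'M[R]_m) (u :: nseq m.-1 u).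
  by have := spectrum_scalar m u; rewrite -[in nseq m u](prednK m_gt0).
have U1 u : (u%:M : 'M[R]_m) *m const_mx 1 = u *: const_mx 1 :> 'cV_m.
  by rewrite mul_scalar_mx.
rewrite /spectrum_is char_poly_distance_laplacian //.
rewrite !(spectrum_two_cells _ _ _ _ (U1 _) V1 (U_r _) V_s).
rewrite !big_cat /= !big_cons big_nil big_flatten big_map /=.
rewrite (eq_bigr (fun i => ('X - (v - lam i)%:P) ^+ 2)); last first.
  by move=> i _; rewrite !big_cons big_nil mulr1.
rewrite prodrXl big_map.
rewrite [5 * m%:R + 3 * n%:R]addrC.
(* q0 and q1 are the characteristic polynomials of the symmetric and the
   antisymmetric quotient. *)
set p1 := \prod_(i <- iota _ _) _; set p2 := \prod_(x <- nseq _ _) _.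
set p3 := \prod_(x <- nseq _ _) _.
set q0 := _ * _ - _; set q1 := _ * _ - _.
have -> : q0 = ('X - (3 * (n%:R + m%:R))%:P) * ('X - 0%:P).
  by apply: quadratic_factor; rewrite /v; ring.
have -> : q1 = ('X - (9 / 2 * (n%:R + m%:R) - 2 + 1 / 2 * Num.sqrt A)%:P)
             * ('X - (9 / 2 * (n%:R + m%:R) - 2 - 1 / 2 * Num.sqrt A)%:P).
  apply: quadratic_factor; rewrite /v; first by field.
  have sqrtA : Num.sqrt A ^+ 2 = A by rewrite sqr_sqrtr.
  rewrite [RHS]mulrC -subr_sqr exprMn sqrtA /A.
  by field.
by rewrite mulr1; ring.
Qed.
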